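(* (i) For every real $c$ with $1\le c<4$ there exists a Toeplitz matrix $M$ such that $M\in TP_2(c)$ but $M\notin TP$. (ii) For every real $c$ with $1\le c<4$ there exists a Hankel matrix $M$ such that $M\in TP_2(c)$ but $M\notin TP$.
   Context: For $c\ge 1$, $TP_2(c)$ denotes the class of all real matrices $M=(a_{i,j})$ with positive entries such that $a_{i,j}a_{i+1,j+1}\ge c\, a_{i,j+1}a_{i+1,j}$ for all $i,j$ (for which these entries exist). $TP$ is the class of totally positive matrices, i.e. matrices all of whose minors are non-negative. A matrix is Toeplitz if it is of the form $(a_{j-i})$, and Hankel if it is of the form $(a_{j+i})$. *)

(* Defs.v *)
From mathcomp Require Import all_boot all_order all_algebra.
From mathcomp Require Import reals.

Set Implicit Arguments.
Unset Strict Implicit.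
Unset Printing Implicit Defensive.

Import Order.TTheory GRing.Theory Num.Theory.
Local Open Scope ring_scope.

Section Classes.
Variables (R : realType) (m n : nat).
Implicit Types (c : R) (M : 'M[R]_(m, n)).

(* The second condition ranges over the pairs (i, j) for which row i.+1 and
   column j.+1 exist; these are i' and j'. *)
Definition TP2 c M : Prop :=
  (forall i j, 0 < M i j) /\
  (forall (i i' : 'I_m) (j j' : 'I_n),
     i' = i.+1 :> nat -> j' = j.+1 :> nat ->
     c * (M i j' * M i' j) <= M i j * M i' j').

(* A minor of order k is given by k increasing row indices f and k increasing
   column indices g; the order k = 0 is harmless, as the empty minor is 1. *)
Definition totally_positive M : Prop :=
  forall (k : nat) (f : 'I_k -> 'I_m) (g : 'I_k -> 'I_n),
    {homo f : x y / (x < y)%N} -> {homo g : x y / (x < y)%N} ->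
    0 <= \det (mxsub f g M).

Definition toeplitz M : Prop :=
  exists a : int -> R, forall i j, M i j = a (j%:Z - i%:Z).

Definition hankel M : Prop :=
  exists a : nat -> R, forall i j, M i j = a (j + i)%N.

End Classes.

(* Main.v *)
Require Import Defs.
From mathcomp Require Import all_boot all_order all_algebra.
From mathcomp Require Import reals.
From mathcomp Require Import boolp polyrcf ring lra zify.

Import Order.TTheory GRing.Theory Num.Theory.
Local Open Scope ring_scope.

(** One family of matrices serves both parts. Put t = 1 / sqrt c, so that
    1/2 < t <= 1, and take the symmetric Toeplitz matrix [band t e n] whose
    entry at distance d from the diagonal is t^(d odd) * e^floor(d^2/4): it is
    1 on the diagonal, t next to it, and a multiple of e further away.

    For small e > 0 it belongs to TP_2(c): the squared entry at distance d
    divided by the product of its two neighbours is exactly t^-2 = c for even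
    d, and t^2 / e for odd d ([weight_logconcave], [TP2_band]).

    At e = 0 it is tridiagonal, and its determinants satisfy
    D(n+2) = D(n+1) - t^2 D(n) ([det_band0_rec]). The characteristic roots of
    this recurrence are not real because t > 1/2, so D cannot stay nonnegative:
    the ratio of consecutive terms would drop by at least 2 t - 1 at each step
    ([continuant_neg]). Hence some determinant is negative at e = 0, and by
    continuity also at a small e > 0 ([det_band_perturb]).

    Multiplying row and column i by e^-binomial(i+1, 2) turns the entry (i, j)
    into t^(i+j odd) * e^-floor((i+j+1)^2/4), which is a Hankel matrix
    ([hankel_congr_band]). Such a positive diagonal congruence preserves TP_2(c)
    and the sign of the determinant. *)

(** * The exponents floor(d^2/4) *)

(** This is floor(d^2/4): the unique exponent, with values 0, 0 at d = 0, 1,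
    whose second difference is 0 at even d and 1 at odd d. *)
Definition quarter_square (d : nat) : nat := (d./2 * uphalf d)%N.

Lemma quarter_square_double h : quarter_square h.*2 = (h * h)%N.
Proof. by rewrite /quarter_square uphalf_double doubleK. Qed.

Lemma quarter_square_doubleS h : quarter_square h.*2.+1 = (h * h.+1)%N.
Proof. by rewrite /quarter_square /= doubleK uphalf_double. Qed.

Lemma quarter_square_gt0 d : (0 < quarter_square d.+2)%N.
Proof. by rewrite /quarter_square muln_gt0. Qed.

(** Dividing (i - j)^2 + (i + j + 1)^2 = 2 i (i+1) + 2 j (j+1) + 1 by 4: exactly
    one of the two squares is odd, and rounding its quarter down removes the
    last 1/4. The identity trades a function of i - j for one of i + j, up to
    terms in i alone and in j alone. *)
Lemma quarter_square_distn (i j : nat) :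
  (quarter_square `|j%:Z - i%:Z| + quarter_square (i + j).+1
     = 'C(i.+1, 2) + 'C(j.+1, 2))%N.
Proof.
wlog le_ij : i j / (i <= j)%N => [hwlog|].
  case: (leqP i j) => [/hwlog //|/ltnW /hwlog].
  by rewrite distnC (addnC i j) [in RHS]addnC.
have eqC2 k : ('C(k.+1, 2) * 2 = k.+1 * k)%N.
  by rewrite bin2 /= muln2 even_halfK // oddM /= andNb.
have -> : `|j%:Z - i%:Z|%N = (j - i)%N by lia.
move: (subnKC le_ij); move: (j - i)%N => d <- {j le_ij}.
rewrite -[d]odd_double_half; move: (odd d) (d./2) => b h.
have := eqC2 i; have := eqC2 (i + (b + h.*2))%N.
case: b; rewrite ?add0n ?add1n.
  have -> : (i + (i + h.*2.+1)).+1 = (i + h).+1.*2 by lia.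
  rewrite quarter_square_double quarter_square_doubleS; nia.
have -> : (i + (i + h.*2)).+1 = (i + h).*2.+1 by lia.
rewrite quarter_square_double quarter_square_doubleS; nia.
Qed.

(** * The perturbed tridiagonal Toeplitz matrix *)

Definition weight {R : comNzRingType} (t e : R) (d : nat) : R :=
  t ^+ odd d * e ^+ quarter_square d.

Definition band {R : comNzRingType} (t e : R) (n : nat) : 'M[R]_n :=
  \matrix_(i, j) weight t e `|j%:Z - i%:Z|.

Section Weight.
Variables (R : realType) (c t e : R).
Hypotheses (c_gt0 : 0 < c) (t_gt0 : 0 < t) (ct2 : c * t ^+ 2 = 1).
Hypotheses (e_gt0 : 0 < e) (e_le : c ^+ 2 * e <= 1).

Lemma weight_gt0 d : 0 < weight t e d.
Proof. by rewrite mulr_gt0 ?exprn_gt0. Qed.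

(** The parameter t is tuned so that this is an equality when the middle index
    d + 1 is even. When it is odd, t sits on the other side, and the surplus
    factor e <= c^-2 on the left makes up for that. *)
Lemma weight_logconcave d :
  c * (weight t e d * weight t e d.+2) <= weight t e d.+1 ^+ 2.
Proof.
rewrite -[d]odd_double_half; move: (odd d) (d./2) => b h.
rewrite /weight /= negbK oddD odd_double oddb addbF.
case: b => /=; rewrite ?add0n ?add1n.
- rewrite -[h.*2.+2]doubleS !quarter_square_doubleS quarter_square_double.
  rewrite le_eqVlt; apply/orP; left; apply/eqP.
  have -> : (h.+1 * h.+2 = h * h.+1 + h.+1 * 2)%N by lia.
  have -> : (h.+1 * h.+1 = h * h.+1 + h.+1)%N by lia.
  rewrite !exprD !exprM; set x := e ^+ h.
  rewrite expr0 expr1 mul1r.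
  transitivity (c * t ^+ 2 * ((x ^+ h.+1) ^+ 2 * (e ^+ h.+1) ^+ 2)); first by ring.
  by rewrite ct2; ring.
- rewrite -[h.*2.+2]doubleS !quarter_square_double quarter_square_doubleS.
  have -> : (h.+1 * h.+1 = h * h + h + h + 1)%N by lia.
  have -> : (h * h.+1 = h * h + h)%N by lia.
  rewrite !exprD expr0 expr1 !mul1r.
  set x := e ^+ (h * h)%N; set y := e ^+ h.
  have -> : c * (x * (x * y * y * e)) = (c * e) * (x * y) ^+ 2 by ring.
  rewrite [leRHS]exprMn ler_pM2r ?exprn_gt0 ?mulr_gt0 ?exprn_gt0 //.
  by rewrite -(ler_pM2l c_gt0) ct2 mulrA -expr2.
Qed.

(** At the diagonal both neighbours are at distance 1, and equality holds. *)
Lemma weight_logconcave0 :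
  c * (weight t e 1 * weight t e 1) <= weight t e 0 ^+ 2.
Proof.
by rewrite /weight /quarter_square /= !expr0 expr1 !mulr1 expr1n -expr2 ct2.
Qed.

Lemma weight_logconcave_int (z : int) :
  c * (weight t e `|(z + 1)%R| * weight t e `|(z - 1)%R|) <= weight t e `|z| ^+ 2.
Proof.
have [->|z0] := eqVneq z 0; first exact: weight_logconcave0.
have := weight_logconcave `|z|%N.-1.
have [z_gt0|z_le0] := leP 0 z.
  have -> : `|z|%N.-1.+2 = `|(z + 1)%R|%N by lia.
  have -> : `|z|%N.-1.+1 = `|z|%N by lia.
  have -> : `|z|%N.-1 = `|(z - 1)%R|%N by lia.
  by rewrite [weight _ _ `|(z - 1)%R| * _]mulrC.
have -> : `|z|%N.-1.+2 = `|(z - 1)%R|%N by lia.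
have -> : `|z|%N.-1.+1 = `|z|%N by lia.
by have -> : `|z|%N.-1 = `|(z + 1)%R|%N by lia.
Qed.

Lemma TP2_band n : TP2 c (band t e n).
Proof.
split=> [i j|i i' j j' ei ej]; rewrite !mxE ?weight_gt0 //.
have := weight_logconcave_int (j%:Z - i%:Z).
have -> : j%:Z - i%:Z + 1 = j'%:Z - i%:Z by lia.
have -> : j%:Z - i%:Z - 1 = j%:Z - i'%:Z by lia.
by have -> : j'%:Z - i'%:Z = j%:Z - i%:Z by lia.
Qed.
End Weight.

Lemma toeplitz_band (R : realType) (t e : R) n : toeplitz (band t e n).
Proof. by exists (fun z => weight t e `|z|) => i j; rewrite mxE. Qed.

(** * Diagonal scaling to a Hankel matrix *)

Definition congr_diag {R : comNzRingType} {n} (d : 'rV[R]_n) (M : 'M[R]_n) :=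
  diag_mx d *m M *m diag_mx d.

Lemma congr_diagE (R : comNzRingType) n (d : 'rV[R]_n) (M : 'M[R]_n) i j :
  congr_diag d M i j = d 0 i * M i j * d 0 j.
Proof. by rewrite /congr_diag mul_mx_diag mul_diag_mx !mxE. Qed.

(** Both sides of each inequality pick up the same factor, the product of the
    scalars of the two rows and the two columns. *)
Lemma TP2_congr_diag (R : realType) n (c : R) (d : 'rV[R]_n) (M : 'M[R]_n) :
  (forall i, 0 < d 0 i) -> TP2 c M -> TP2 c (congr_diag d M).
Proof.
move=> d_gt0 [M_gt0 cM]; split=> [i j|i i' j j' ei ej].
  by rewrite congr_diagE !mulr_gt0.
rewrite !congr_diagE.
set s := d 0 i * d 0 i' * d 0 j * d 0 j'.
have s_gt0 : 0 < s by rewrite !mulr_gt0.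
have -> : c * (d 0 i * M i j' * d 0 j' * (d 0 i' * M i' j * d 0 j))
        = s * (c * (M i j' * M i' j)) by rewrite /s; ring.
have -> : d 0 i * M i j * d 0 j * (d 0 i' * M i' j' * d 0 j')
        = s * (M i j * M i' j') by rewrite /s; ring.
by rewrite ler_pM2l // cM.
Qed.

Lemma det_congr_diag_lt0 (R : realDomainType) n (d : 'rV[R]_n) (M : 'M[R]_n) :
  (forall i, 0 < d 0 i) -> \det M < 0 -> \det (congr_diag d M) < 0.
Proof.
move=> d_gt0 detM; rewrite /congr_diag !det_mulmx det_diag.
have p_gt0 : 0 < \prod_i d 0 i by apply: prodr_gt0.
by rewrite pmulr_llt0 // pmulr_rlt0.
Qed.

Lemma not_TP_det_lt0 (R : realType) n (M : 'M[R]_n) :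
  \det M < 0 -> ~ totally_positive M.
Proof.
move=> detM /(_ n id id (fun _ _ => id) (fun _ _ => id)).
by rewrite mxsub_id leNgt detM.
Qed.

Definition hankel_scale {R : realType} (e : R) n : 'rV[R]_n :=
  \row_i e ^- 'C(i.+1, 2).

Lemma hankel_congr_band (R : realType) (t e : R) n :
  e != 0 -> hankel (congr_diag (hankel_scale e n) (band t e n)).
Proof.
move=> e0; exists (fun k => t ^+ odd k * e ^- quarter_square k.+1) => i j.
rewrite congr_diagE !mxE /weight (addnC (val j)).
have -> : odd `|j%:Z - i%:Z| = odd (i + j) by lia.
have := quarter_square_distn i j.
move: (quarter_square `|_|) (quarter_square _.+1) 'C(i.+1, 2) 'C(j.+1, 2) => q k a b qk.
have [ek ea eb] : [/\ e ^+ k != 0, e ^+ a != 0 & e ^+ b != 0].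
  by split; rewrite expf_neq0.
have -> : e ^+ q = e ^+ a * e ^+ b / e ^+ k by rewrite -exprD -qk exprD mulfK.
by field; rewrite ek ea eb.
Qed.

(** * Negative determinants *)

Lemma weight0_far (R : comNzRingType) (t : R) d :
  (1 < d)%N -> weight t 0 d = 0.
Proof.
case: d => [|[|d]] // _.
by rewrite /weight expr0n gtn_eqF ?quarter_square_gt0 // mulr0.
Qed.

Lemma band_minor (R : comNzRingType) (t e : R) n :
  row' ord0 (col' ord0 (band t e n.+1)) = band t e n.
Proof. by apply/matrixP=> i j; rewrite !mxE; congr weight; rewrite /= /bump; lia. Qed.

(** Laplace expansion along the first row, then along the first column of the
    second minor: only the entries 1 and t of the first row and the entry t of
    that column survive. *)
Lemma det_band0_rec (R : comNzRingType) (t : R) n :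
  \det (band t 0 n.+2)
    = \det (band t 0 n.+1) - t ^+ 2 * \det (band t 0 n).
Proof.
rewrite (expand_det_row _ ord0) !big_ord_recl big1 => [|k _]; last first.
  by rewrite mxE weight0_far ?mul0r //= /bump; lia.
rewrite {1}/cofactor band_minor /= expr0 mul1r addr0.
rewrite {1}/cofactor [\det (row' _ _)](expand_det_col _ ord0).
rewrite big_ord_recl big1 => [|k _]; last first.
  by rewrite !mxE weight0_far ?mul0r //= /bump; lia.
rewrite /cofactor.
rewrite (_ : row' ord0 (col' ord0 _) = band t 0 n); last first.
  apply/matrixP=> i j; rewrite !mxE; congr weight; rewrite /= /bump; lia.
rewrite !mxE /= /weight /quarter_square /=; ring.
Qed.

Lemma det_band_small (R : comNzRingType) (t e : R) :
  \det (band t e 0) = 1 /\ \det (band t e 1) = 1.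
Proof.
by split; rewrite ?det_mx00 // det_mx11 mxE /weight /quarter_square /= !expr0 mul1r.
Qed.

(** If D stayed nonnegative it would stay positive, since D(n+1) = 0 forces
    D(n+2) = - t^2 D(n). The ratios r = D(n+1) / D(n) are then positive, and
    r |-> 1 - t^2 / r decreases r by r + t^2 / r - 1 >= 2 t - 1 > 0, which
    cannot go on for ever. *)
Lemma continuant_neg (R : realType) (t : R) (D : nat -> R) :
  2^-1 < t -> D 0%N = 1 -> D 1%N = 1 ->
  (forall n, D n.+2 = D n.+1 - t ^+ 2 * D n) -> exists n, D n < 0.
Proof.
move=> t_gt D0 D1 Drec; apply: contrapT => D_nneg.
have D_ge0 n : 0 <= D n by rewrite leNgt; apply/negP=> Dn; apply: D_nneg; exists n.
have t_gt0 : 0 < t by lra.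
have D_gt0 n : 0 < D n.
  elim: n => [|n IH]; first by rewrite D0.
  rewrite lt_neqAle D_ge0 andbT; apply/eqP => Dn.
  have := D_ge0 n.+2; rewrite Drec -Dn sub0r oppr_ge0 leNgt.
  by rewrite mulr_gt0 ?exprn_gt0.
have ratio n : D n.+1 <= (1 - n%:R * (2 * t - 1)) * D n.
  elim: n => [|n IH]; first by rewrite D0 D1; lra.
  rewrite Drec -(ler_pM2r (D_gt0 n)) -natr1.
  move: (D n) (D n.+1) (D_gt0 n) (D_gt0 n.+1) IH => y x y0 x0 xy.
  (* x / y is the current ratio: (x - t y)^2 >= 0 is r + t^2 / r >= 2 t. *)
  have := ler_wpM2r (ltW x0) xy; have := sqr_ge0 (x - t * y); nra.
have d_gt0 : 0 < 2 * t - 1 by lra.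
have [n hn] : exists n, 1 < n%:R * (2 * t - 1).
  exists (Num.bound (2 * t - 1)^-1); rewrite -ltr_pdivrMr // mul1r.
  by apply: archi_boundP; rewrite invr_ge0 ltW.
have := ratio n; rewrite leNgt => /negP; apply.
by apply: lt_trans (D_gt0 n.+1); rewrite pmulr_llt0 // subr_lt0.
Qed.

Lemma map_band (R S : comNzRingType) (f : {rmorphism R -> S}) (t e : R) n :
  map_mx f (band t e n) = band (f t) (f e) n.
Proof. by apply/matrixP=> i j; rewrite !mxE /weight rmorphM !rmorphXn. Qed.

(** The determinant is a polynomial in e: it is evaluated from the band matrix
    over the polynomial ring whose second parameter is the indeterminate. *)
Lemma det_band_perturb (R : realType) (t b : R) n :
  0 < b -> \det (band t 0 n) < 0 ->
  exists e, [/\ 0 < e, e <= b & \det (band t e n) < 0].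
Proof.
move=> b_gt0 det0; pose p := \det (band t%:P 'X n).
have pE e : p.[e] = \det (band t e n).
  by rewrite -[LHS]/(horner_eval e p) -det_map_mx map_band /= !horner_evalE hornerC hornerX.
have [d d_gt0 near0] := poly_cont 0 p (e := - \det (band t 0 n)) ltac:(by rewrite oppr_gt0).
pose e := Num.min b (d / 2).
have e_gt0 : 0 < e by rewrite lt_min b_gt0 divr_gt0.
exists e; split=> //; first by rewrite ge_min lexx.
have /near0 : `|e - 0| < d.
  by rewrite subr0 gtr0_norm // gt_min ltr_pdivrMr // mulr2n mulrDr mulr1 ltrDl d_gt0 orbT.
by rewrite !pE => /ltr_normlW; lra.
Qed.

Lemma TP2_band_neg (R : realType) (c : R) :
  1 <= c < 4 ->
  exists (t e : R) (n : nat), [/\ 0 < e, TP2 c (band t e n) & \det (band t e n) < 0].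
Proof.
move=> /andP[c_ge1 c_lt4]; have c_gt0 : 0 < c by lra.
pose t := (Num.sqrt c)^-1.
have s_gt0 : 0 < Num.sqrt c by rewrite sqrtr_gt0.
have t_gt0 : 0 < t by rewrite invr_gt0.
have ct2 : c * t ^+ 2 = 1 by rewrite exprVn sqr_sqrtr ?divff ?gt_eqF ?ltW.
have t_gt : 2^-1 < t.
  rewrite ltNge; apply/negP => t_le; have t2 : t ^+ 2 <= 4^-1 by nra.
  by have := ler_wpM2l (ltW c_gt0) t2; rewrite ct2; lra.
have [n detn] := continuant_neg R t (fun n => \det (band t 0 n)) t_gt
  (det_band_small R t 0).1 (det_band_small R t 0).2 (det_band0_rec R t).
have [e [e_gt0 e_le det_lt0]] :=
  det_band_perturb R t (c ^- 2) n ltac:(by rewrite invr_gt0 exprn_gt0) detn.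
exists t, e, n; split=> //; apply: TP2_band => //.
by rewrite mulrC -ler_pdivlMr ?exprn_gt0 // mul1r.
Qed.

Theorem mainTheorem5 (R : realType) :
  (forall c : R, 1 <= c < 4 ->
     exists (m n : nat) (M : 'M[R]_(m, n)),
       [/\ toeplitz M, TP2 c M & ~ totally_positive M]) /\
  (forall c : R, 1 <= c < 4 ->
     exists (m n : nat) (M : 'M[R]_(m, n)),
       [/\ hankel M, TP2 c M & ~ totally_positive M]).
Proof.
split=> c /TP2_band_neg [t [e [n [e_gt0 TP2c det_lt0]]]].
  exists n, n, (band t e n); split=> //; first exact: toeplitz_band.
  exact: not_TP_det_lt0.
have d_gt0 i : 0 < hankel_scale e n 0 i by rewrite mxE invr_gt0 exprn_gt0.
exists n, n, (congr_diag (hankel_scale e n) (band t e n)); split.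
- by apply: hankel_congr_band; rewrite gt_eqF.
- exact: TP2_congr_diag.
- by apply: not_TP_det_lt0; apply: det_congr_diag_lt0.
Qed.
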